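(* Let $(A,\Phi)$ be a dual $\ell$CEDS and $V$ be a vector space. Put $C_A(V)=S(A\otimes V)\otimes V$, whose elements are written as linear spans of terms $a_1x_1\ldots a_nx_n\mid x$, with $n\geqslant 0$, $a_1,\ldots,a_n\in A$ and $x_1,\ldots,x_n,x\in V$. For any $a\in A$, define a product $\diamond_a$ on $C_A(V)$ by $$(a_1x_1\ldots a_kx_k\mid x)\diamond_a(b_1y_1\ldots b_ly_l\mid y)=\sum a'_1x_1\ldots a'_kx_k\,a'_{k+1}x\,b_1y_1\ldots b_ly_l\mid y,$$ with $$\sum a'_1\otimes\ldots\otimes a'_{k+1}=\left(\mathrm{Id}^{\otimes(k-1)}\otimes\Phi\right)\circ\left(\mathrm{Id}^{\otimes(k-2)}\otimes\Phi\otimes\mathrm{Id}\right)\circ\ldots\circ\left(\Phi\otimes\mathrm{Id}^{\otimes(k-1)}\right)(a\otimes a_1\otimes\ldots\otimes a_k).$$ Then $(C_A(V),\diamond)$ is the free $(A,\Phi)$-permutative algebra generated by $V$.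
   Context: $\mathbb{K}$ is a field of characteristic zero and all vector spaces are over $\mathbb{K}$; $\tau$ is the flip of $A\otimes A$; $S(W)$ is the symmetric algebra of a vector space $W$. The space $V$ is seen in $C_A(V)$ through the terms with $n=0$. For $k=0$, the formula for $\sum a'_1\otimes\ldots\otimes a'_{k+1}$ is just $a$. A dual $\ell$CEDS is a pair $(A,\Phi)$ with $A$ a vector space and $\Phi:A\otimes A\to A\otimes A$ linear such that $(\mathrm{Id}\otimes\Phi)\circ(\Phi\otimes\mathrm{Id})\circ(\mathrm{Id}\otimes\Phi)=(\Phi\otimes\mathrm{Id})\circ(\mathrm{Id}\otimes\tau)\circ(\Phi\otimes\mathrm{Id})$ and $(\Phi\otimes\mathrm{Id})\circ(\tau\otimes\mathrm{Id})\circ(\mathrm{Id}\otimes\tau)\circ(\mathrm{Id}\otimes\Phi)=(\mathrm{Id}\otimes\tau)\circ(\mathrm{Id}\otimes\Phi)\circ(\Phi\otimes\mathrm{Id})\circ(\tau\otimes\mathrm{Id})$. With formal Sweedler notation $\Phi(a\otimes b)=\sum a'\curvearrowright b'\otimes a''\blacktriangleright b''$, an $(A,\Phi)$-permutative algebra is a vector space $W$ with products $\diamond_a:W\otimes W\to W$, depending linearly on $a\in A$, such that for all $x,y,z\in W$, $a,b\in A$: $$(x\diamond_b y)\diamond_a z=\sum x\diamond_{a'\curvearrowright b'}(y\diamond_{a''\blacktriangleright b''}z),\qquad x\diamond_a(y\diamond_b z)=y\diamond_b(x\diamond_a z).$$ *)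

(* Defs.v *)
From HB Require Import structures.
From mathcomp Require Import all_boot all_algebra.
From mathcomp Require Import boolp.
From mathcomp Require Import finmap monalg.

Set Implicit Arguments.
Unset Strict Implicit.
Unset Printing Implicit Defensive.

Import GRing.Theory.
Import Quotient.Exports.
Local Open Scope ring_scope.
Local Open Scope quotient_scope.

Section Span.
Variables (R : nzRingType) (M : lmodType R).

Definition span (G : M -> Prop) : pred M := fun m =>
  `[< exists2 s : seq (R * M),
        forall p, p \in s -> G p.2 & m = \sum_(p <- s) p.1 *: p.2 >].

Variable G : M -> Prop.

Lemma span_gen m : G m -> m \in span G.
Proof.
move=> Gm; apply/asboolP; exists [:: (1, m)]; last by rewrite big_seq1 scale1r.
by move=> p; rewrite inE => /eqP->.
Qed.

Lemma span_ind (Q : M -> Prop) :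
  (forall c x y, Q x -> Q y -> Q (c *: x + y)) -> Q 0 ->
  (forall m, G m -> Q m) -> forall m, m \in span G -> Q m.
Proof.
move=> QD Q0 QG m /asboolP[s + ->].
elim: s => [|p s IHs] Gs; first by rewrite big_nil.
rewrite big_cons; apply: QD; first by apply/QG/Gs/mem_head.
by apply: IHs => q qs; apply: Gs; rewrite inE qs orbT.
Qed.

Lemma span_submod : submod_closed (span G).
Proof.
split; first by apply/asboolP; exists [::] => //; rewrite big_nil.
move=> c x y /asboolP[s Gs ->] /asboolP[t Gt ->]; apply/asboolP.
exists ([seq (c * p.1, p.2) | p <- s] ++ t).
  by move=> p; rewrite mem_cat => /orP[/mapP[q /Gs Gq ->]|/Gt].
rewrite big_cat big_map /= scaler_sumr; congr (_ + _).
by apply: eq_bigr => p _; rewrite scalerA.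
Qed.

HB.instance Definition _ :=
  GRing.isZmodClosed.Build M (span G) (GRing.submod_closedB span_submod).

Definition span_zmod : zmodClosed M := GRing.ZmodClosed.clone M (span G) _.

Definition mod_span : Type := Quotient.quot span_zmod.

HB.instance Definition _ := GRing.Zmodule.on mod_span.

Definition mod_pi (m : M) : mod_span := \pi_(Quotient.quot span_zmod) m.

Lemma mod_piP x y : mod_pi x = mod_pi y <-> x - y \in span G.
Proof.
rewrite /mod_pi; split=> [/eqP|xy]; first by rewrite -Quotient.idealrBE.
by apply/eqP; rewrite -Quotient.idealrBE.
Qed.

Lemma mod_piB : {morph mod_pi : x y / x - y}.
Proof. exact: raddfB. Qed.

Lemma mod_pi_repr (x : mod_span) : mod_pi (repr x) = x.
Proof. exact: reprK. Qed.

Definition mod_scale (c : R) (x : mod_span) : mod_span := mod_pi (c *: repr x).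

Lemma mod_scaleE c x : mod_scale c (mod_pi x) = mod_pi (c *: x).
Proof.
apply/mod_piP; rewrite -scalerBr -[_ *: _]addr0.
have [s0 sD] := span_submod; apply: sD => //.
by apply/mod_piP; rewrite mod_pi_repr.
Qed.

Lemma mod_piD : {morph mod_pi : x y / x + y}.
Proof. exact: raddfD. Qed.

Fact mod_scaleA a b x : mod_scale a (mod_scale b x) = mod_scale (a * b) x.
Proof. by rewrite -[x]mod_pi_repr !mod_scaleE scalerA. Qed.
Fact mod_scale1 : left_id 1 mod_scale.
Proof. by move=> x; rewrite -[x]mod_pi_repr mod_scaleE scale1r. Qed.
Fact mod_scaleDr : right_distributive mod_scale +%R.
Proof.
move=> a x y; rewrite -[x]mod_pi_repr -[y]mod_pi_repr -mod_piD !mod_scaleE.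
by rewrite scalerDr mod_piD.
Qed.
Fact mod_scaleDl x : {morph mod_scale^~ x : a b / a + b}.
Proof.
by move=> a b; rewrite -[x]mod_pi_repr !mod_scaleE scalerDl mod_piD.
Qed.

HB.instance Definition _ := GRing.Zmodule_isLmodule.Build R mod_span
  mod_scaleA mod_scale1 mod_scaleDr mod_scaleDl.

Fact mod_pi_linear : linear mod_pi.
Proof. by move=> c x y; rewrite mod_piD -mod_scaleE. Qed.
HB.instance Definition _ :=
  GRing.isLinear.Build R M mod_span *:%R mod_pi mod_pi_linear.

End Span.

Section Tensor.
Variables (K : fieldType) (A B : lmodType K).

Inductive bilin_rel : {malg K[(A * B)%type]} -> Prop :=
| BilinL c a a' b :
    bilin_rel (<< (c *: a + a', b) >> - (c *: << (a, b) >> + << (a', b) >>))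
| BilinR c a b b' :
    bilin_rel (<< (a, c *: b + b') >> - (c *: << (a, b) >> + << (a, b') >>)).

Definition tensor : Type := mod_span bilin_rel.
HB.instance Definition _ := GRing.Lmodule.on tensor.

Definition tens (a : A) (b : B) : tensor := mod_pi bilin_rel << (a, b) >>.

Lemma tens_bilinear : bilinear_for *:%R *:%R tens.
Proof.
split=> [b c a a'|a c b b'] /=; rewrite -[RHS](linearP (mod_pi bilin_rel));
  apply/mod_piP/span_gen; [exact: BilinL|exact: BilinR].
Qed.

Lemma tensor_ind (Q : tensor -> Prop) :
  (forall c s t, Q s -> Q t -> Q (c *: s + t)) -> Q 0 ->
  (forall a b, Q (tens a b)) -> forall t, Q t.
Proof.
move=> QD Q0 Qt t; rewrite -[t]mod_pi_repr.
rewrite [repr _]monalgE; elim: (enum_fset _) => [|p s IHs].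
  by rewrite big_nil linear0.
have mU (c : K) q : << c *g q >> = c *: << q >> :> {malg K[(A * B)%type]}.
  by apply/malgP=> r; rewrite mcoeffZ !mcoeffU mulr_natr.
rewrite big_cons linearD mU linearZ; apply: QD => //.
by case: p => a b; apply: Qt.
Qed.

Variable W : lmodType K.
Implicit Type f : A -> B -> W.

Definition free_lift f (m : {malg K[(A * B)%type]}) : W :=
  \sum_(p <- msupp m) m@_p *: f p.1 p.2.

(* The image of t under the linear map a (x) b |-> f a b, i.e. the Sweedler sum
   of the f a b over t = \sum a (x) b. It is only meaningful for bilinear f,
   see tliftE. *)
Definition tlift f (t : tensor) : W :=
  free_lift f (repr (t : Quotient.quot (span_zmod bilin_rel))).

Lemma free_liftEw f (d : {fset (A * B)%type}) m : (msupp m `<=` d)%fset ->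
  free_lift f m = \sum_(p <- d) m@_p *: f p.1 p.2.
Proof.
move=> le; rewrite /free_lift (big_fset_incl _ le) // => p _ /mcoeff_outdom->.
by rewrite scale0r.
Qed.

Fact free_lift_linear f : linear (free_lift f).
Proof.
move=> c x y; pose d := (msupp x `|` msupp y `|` msupp (c *: x + y))%fset.
rewrite !(@free_liftEw f d); try by rewrite /d ?fsubsetUr // -fsetUA
  ?fsubsetUl // fsetUCA fsubsetUl.
rewrite scaler_sumr -big_split; apply: eq_bigr => p _.
by rewrite mcoeffD mcoeffZ scalerDl scalerA.
Qed.
HB.instance Definition _ f :=
  GRing.isLinear.Build K {malg K[(A * B)%type]} W *:%R (free_lift f)
    (free_lift_linear f).

Lemma free_liftU f p : free_lift f << p >> = f p.1 p.2.
Proof. by rewrite (free_liftEw _ msuppU_le) big_seq_fset1 mcoeffUU scale1r. Qed.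

Variable f : A -> B -> W.
Hypothesis fL : bilinear_for *:%R *:%R f.

Lemma tlift_pi m : tlift f (mod_pi bilin_rel m) = free_lift f m.
Proof.
apply/eqP; rewrite -subr_eq0 -linearB; apply/eqP.
have /mod_piP := mod_pi_repr (mod_pi bilin_rel m).
apply: (span_ind (Q := fun m => free_lift f m = 0)).
- by move=> c x y xK yK; rewrite linearP /= xK yK scaler0 addr0.
- exact: linear0.
- case: fL => f1 f2 _ [c a a' b|c a b b']; rewrite linearB linearP /= !free_liftU.
    by rewrite /= (f1 b c a) subrr.
  by rewrite /= (f2 a c b) subrr.
Qed.

Lemma tliftE a b : tlift f (tens a b) = f a b.
Proof. by rewrite tlift_pi free_liftU. Qed.

Lemma tlift_linear : linear (tlift f).
Proof.
move=> c x y; rewrite -[x]mod_pi_repr -[y]mod_pi_repr -linearP !tlift_pi.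
exact: linearP.
Qed.

End Tensor.

(* The symmetric algebra of W, as the polynomial algebra on indeterminates X_w,
   w : W, modulo the ideal generated by X_(c v + w) - (c X_v + X_w). *)
Section SymmetricAlgebra.
Variables (K : fieldType) (W : lmodType K).

Local Notation sym_poly := {malg K[{cmonom W}]}.

Definition sym_var (w : W) : sym_poly := << ucm w >>.

Fact sym_var1 w : (sym_var w)@_mone = 0.
Proof. by rewrite /sym_var mcoeffU cm1_eq1. Qed.

Inductive sym_rel : sym_poly -> Prop :=
  SymRel c v w :
    sym_rel (sym_var (c *: v + w) - (c *: sym_var v + sym_var w)).

(* The regular module sym_poly^o makes this the ideal generated by sym_rel. *)
Definition sym_ideal : pred sym_poly := @span sym_poly sym_poly^o sym_rel.

Fact sym_ideal_closed : idealr_closed sym_ideal.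
Proof.
have [s0 sD] := @span_submod sym_poly sym_poly^o sym_rel; split=> //.
apply/negP=> s1; suff: (1 : sym_poly)@_mone = 0 :> K.
  by move/eqP; rewrite mcoeff1 eqxx oner_eq0.
move: s1; apply: (@span_ind sym_poly sym_poly^o sym_rel
  (fun m => (m : sym_poly)@_mone = 0)) => [c x y x0 y0||_ [c v w]].
- by rewrite mcoeffD (rmorphM (mcoeff mone)) /= x0 y0 mulr0 addr0.
- exact: mcoeff0.
- rewrite mcoeffB mcoeffD mcoeffZ; transitivity (0 - (c * 0 + 0) : K).
    by congr (_ - (_ * _ + _)); exact: sym_var1.
  by rewrite mulr0 addr0 subr0.
Qed.
HB.instance Definition _ := isIdealr.Build sym_poly sym_ideal sym_ideal_closed.

Definition sym_idealr : idealr sym_poly := Idealr.clone _ sym_ideal _.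

Definition Sym : Type := {ideal_quot sym_idealr}.
HB.instance Definition _ := GRing.ComNzRing.on Sym.

Definition sym_pi (p : sym_poly) : Sym := \pi_{ideal_quot sym_idealr} p.

Fact sym_pi_additive : zmod_morphism sym_pi.
Proof. exact: raddfB. Qed.
HB.instance Definition _ :=
  GRing.isZmodMorphism.Build sym_poly Sym sym_pi sym_pi_additive.

Fact sym_pi_multiplicative : monoid_morphism sym_pi.
Proof. by split; [exact: rmorph1 | exact: rmorphM]. Qed.
HB.instance Definition _ :=
  GRing.isMonoidMorphism.Build sym_poly Sym sym_pi sym_pi_multiplicative.

Lemma sym_piP x y : sym_pi x = sym_pi y <-> x - y \in sym_ideal.
Proof.
rewrite /sym_pi; split=> [/eqP|xy]; first by rewrite -Quotient.idealrBE.
by apply/eqP; rewrite -Quotient.idealrBE.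
Qed.

Lemma sym_pi_repr (x : Sym) : sym_pi (repr x) = x.
Proof. exact: reprK. Qed.

Definition sym_scale (c : K) (x : Sym) : Sym := sym_pi c%:MP * x.

Fact sym_scaleA a b x : sym_scale a (sym_scale b x) = sym_scale (a * b) x.
Proof.
rewrite /sym_scale [LHS]mulrA; congr (_ * _).
by rewrite -[LHS](rmorphM sym_pi); congr (sym_pi _); symmetry; apply: mpolyCM.
Qed.
Fact sym_scale1 : left_id 1 sym_scale.
Proof.
move=> x; rewrite -[RHS]mul1r; congr (_ * _).
by rewrite -[RHS](rmorph1 sym_pi); congr (sym_pi _); apply: mpolyC1E.
Qed.
Fact sym_scaleDr : right_distributive sym_scale +%R.
Proof. by move=> a x y; apply: mulrDr. Qed.
Fact sym_scaleDl x : {morph sym_scale^~ x : a b / a + b}.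
Proof.
move=> a b; rewrite -[RHS]mulrDl; congr (_ * _).
by rewrite -[RHS](raddfD sym_pi); congr (sym_pi _); apply: monalgUD.
Qed.
HB.instance Definition _ := GRing.Zmodule_isLmodule.Build K Sym
  sym_scaleA sym_scale1 sym_scaleDr sym_scaleDl.

Fact sym_scaleAl (c : K) (x y : Sym) : c *: (x * y) = (c *: x) * y.
Proof. exact: mulrA. Qed.
HB.instance Definition _ := GRing.Lmodule_isLalgebra.Build K Sym sym_scaleAl.
HB.instance Definition _ := GRing.Lalgebra_isComAlgebra.Build K Sym.

Fact sym_pi_scalable : scalable sym_pi.
Proof.
move=> c x; rewrite -[RHS](rmorphM sym_pi); congr (sym_pi _).
by symmetry; apply: mul_malgC.
Qed.
HB.instance Definition _ :=
  GRing.isScalable.Build K sym_poly Sym *:%R sym_pi sym_pi_scalable.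

Definition sym_in (w : W) : Sym := sym_pi (sym_var w).

Fact sym_in_linear : linear sym_in.
Proof.
move=> c v w; rewrite -[RHS](linearP sym_pi).
by apply/sym_piP/(@span_gen sym_poly sym_poly^o).
Qed.
HB.instance Definition _ := GRing.isLinear.Build K W Sym *:%R sym_in
  sym_in_linear.

End SymmetricAlgebra.

Section TensorPowers.
Variables (K : fieldType) (A : lmodType K).

Definition tmap (B C D E : lmodType K) (f : B -> D) (g : C -> E) :
    tensor B C -> tensor D E :=
  tlift (fun b c => tens (f b) (g c)).

Definition tflip (t : tensor A A) : tensor A A := tlift (fun a b => tens b a) t.

Definition tassoc (B C D : lmodType K) :
    tensor (tensor B C) D -> tensor B (tensor C D) :=
  tlift (fun bc d => tlift (fun b c => tens b (tens c d)) bc).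

Definition tassocV (B C D : lmodType K) :
    tensor B (tensor C D) -> tensor (tensor B C) D :=
  tlift (fun b => tlift (fun c => tens (tens b c))).

(* tpow n is the (n + 1)-st tensor power of A, bracketed to the right. *)
Fixpoint tpow n : lmodType K := if n is n'.+1 then tensor A (tpow n') else A.

(* f (x) Id^(x)n *)
Definition slot0 (f : tensor A A -> tensor A A) n : tpow n.+1 -> tpow n.+1 :=
  if n is n'.+1 return tpow n.+1 -> tpow n.+1 then
    @tassoc A A (tpow n') \o tmap f id \o @tassocV A A (tpow n')
  else f.

(* slot f i is Id^(x)i (x) f (x) Id^(x)(n - 1 - i) on tpow n, for i < n; outside
   of this range, it is the identity. *)
Fixpoint slot (f : tensor A A -> tensor A A) (i : nat) n : tpow n -> tpow n :=
  match n return tpow n -> tpow n with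
  | 0 => id
  | n'.+1 => if i is i'.+1 then tmap id (@slot f i' n') else @slot0 f n'
  end.

Definition dual_lCEDS (Phi : {linear tensor A A -> tensor A A}) : Prop :=
  let IdPhi := @slot Phi 1 2 in let PhiId := @slot Phi 0 2 in
  let IdTau := @slot tflip 1 2 in let TauId := @slot tflip 0 2 in
  IdPhi \o PhiId \o IdPhi =1 PhiId \o IdTau \o PhiId /\
  PhiId \o TauId \o IdTau \o IdPhi =1 IdTau \o IdPhi \o PhiId \o TauId.

(* (Id^(x)(k-1) (x) Phi) o ... o (Phi (x) Id^(x)(k-1)) *)
Definition Phi_chain (Phi : tensor A A -> tensor A A) k (t : tpow k) : tpow k :=
  foldl (fun u i => slot Phi i u) t (iota 0 k).

End TensorPowers.

Section PermutativeAlgebras.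
Variables (K : fieldType) (A : lmodType K).
Variable Phi : {linear tensor A A -> tensor A A}.

(* A linear family of products x <>_a y = d a x y, as a trilinear map. *)
Definition trilinear (W : lmodType K) (d : A -> W -> W -> W) : Prop :=
  (forall x y, linear (fun a => d a x y)) /\
  (forall a, bilinear_for *:%R *:%R (d a)).

Definition permutative (W : lmodType K) (d : A -> W -> W -> W) : Prop :=
  [/\ trilinear d,
      forall a b x y z,
        d a (d b x y) z =
        tlift (fun a' a'' => d a' x (d a'' y z)) (Phi (tens a b))
    & forall a b x y z, d a x (d b y z) = d b y (d a x z)].

Definition product_morphism (W W' : lmodType K)
    (d : A -> W -> W -> W) (d' : A -> W' -> W' -> W') (F : W -> W') : Prop :=
  forall a x y, F (d a x y) = d' a (F x) (F y).

Definition free_permutative (V C : lmodType K) (d : A -> C -> C -> C)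
    (i : {linear V -> C}) : Prop :=
  permutative d /\
  forall (W : lmodType K) (d' : A -> W -> W -> W), permutative d' ->
  forall f : {linear V -> W},
  exists F : {linear C -> W},
    [/\ product_morphism d d' F, forall x, F (i x) = f x &
        forall F' : {linear C -> W},
          product_morphism d d' F' -> (forall x, F' (i x) = f x) -> F' =1 F].

End PermutativeAlgebras.

Section CA.
Variables (K : fieldType) (A V : lmodType K).
Implicit Types (s : seq (A * V)) (x y : V).

Definition CA : lmodType K := tensor (Sym (tensor A V)) V.

(* a_1 x_1 ... a_n x_n in S(A (x) V), for s = [:: (a_1, x_1); ...; (a_n, x_n)] *)
Definition sym_word s : Sym (tensor A V) :=
  \prod_(p <- s) sym_in (tens p.1 p.2).

(* a_1 x_1 ... a_n x_n | x *)
Definition CA_term s x : CA := tens (sym_word s) x.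

Fact CA_in_linear : linear (CA_term [::]).
Proof. exact: (tens_bilinear _ _).2. Qed.
Definition CA_in x : CA := CA_term [::] x.
HB.instance Definition _ := GRing.isLinear.Build K V CA *:%R CA_in CA_in_linear.

(* a (x) a_1 (x) ... (x) a_k *)
Fixpoint CA_tens (a : A) s : tpow A (size s) :=
  if s is p :: s' then tens a (CA_tens p.1 s') else a.

(* The linear map a'_1 (x) ... (x) a'_(k+1) |-> a'_1 x_1 ... a'_k x_k a'_(k+1) x *)
Fixpoint CA_decorate s x : tpow A (size s) -> Sym (tensor A V) :=
  if s is p :: s' return tpow A (size s) -> Sym (tensor A V) then
    tlift (fun a t => sym_in (tens a p.2) * @CA_decorate s' x t)
  else fun a => sym_in (tens a x).

Definition CA_product (Phi : {linear tensor A A -> tensor A A})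
    (d : A -> CA -> CA -> CA) : Prop :=
  trilinear d /\
  forall a s x t y,
    d a (CA_term s x) (CA_term t y) =
    tens (@CA_decorate s x (Phi_chain Phi (CA_tens a s)) * sym_word t) y.

End CA.

(* Main.v *)
(* For X = (m | x) in C_A(V) the product X <>_a (w | y) is (L_a(X) w | y), where
   L_a(X) in S(A (x) V) satisfies
     L_a(1 | x) = a x,
     L_a(b y . m | x) = sum (p y) L_q(m | x)  over  Phi(a (x) b) = sum p (x) q.
   The second axiom of a dual lCEDS says that the operators
   g |-> (a |-> sum (p y) g(q)) on linear maps g : A -> S(A (x) V) commute, so
   that this recursion is well-defined on the symmetric algebra; unfolding it on
   words gives the composite of the maps Id (x) Phi (x) Id. The first axiom
   gives L_a(L_b(X) n | y) = sum L_p(X) L_q(n | y) over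
   Phi(a (x) b) = sum p (x) q, by induction on X, and this is the first identity
   of permutative algebras; the second one is the commutativity of S(A (x) V).
   In a permutative algebra W with a linear map f : V -> W, the operators
   w |-> f(x) <>_a w commute, hence S(A (x) V) acts on W, and the morphism
   extending f is (m | x) |-> m . f(x); it is multiplicative because L_a(X) acts
   as w |-> F(X) <>_a w, again by induction on X. *)
Require Import Defs.
From HB Require Import structures.
From mathcomp Require Import all_boot all_algebra.
From mathcomp Require Import boolp functions.
From mathcomp Require Import finmap monalg.

Set Implicit Arguments.
Unset Strict Implicit.
Unset Printing Implicit Defensive.

Import GRing.Theory.
Local Open Scope ring_scope.

(** * Linear maps out of a tensor product *)

(* A constant rather than the notation [linear], so that the tactic [lin] below
   can recognize it. *)
Definition lin (K : fieldType) (U V : lmodType K) (f : U -> V) :=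
  forall c x y, f (c *: x + y) = c *: f x + f y.

Section Lin.
Variable K : fieldType.
Implicit Types (U V A B : lmodType K).

Lemma lin0 U V (f : U -> V) : lin f -> f 0 = 0.
Proof. by move=> /(_ (-1) 0 0); rewrite scaler0 addr0 scaleN1r addNr. Qed.

Lemma linZ U V (f : U -> V) c x : lin f -> f (c *: x) = c *: f x.
Proof. by move=> fL; rewrite -[c *: x]addr0 fL lin0 // addr0. Qed.

Lemma linD U V (f : U -> V) x y : lin f -> f (x + y) = f x + f y.
Proof. by move=> fL; rewrite -[x in LHS]scale1r fL scale1r. Qed.

Lemma linB U V (f : U -> V) x y : lin f -> f (x - y) = f x - f y.
Proof. by move=> fL; rewrite linD // -scaleN1r linZ // scaleN1r. Qed.

Lemma lin_sum U V (f : U -> V) I r (G : I -> U) :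
  lin f -> f (\sum_(i <- r) G i) = \sum_(i <- r) f (G i).
Proof.
by move=> fL; apply: (big_morph f) => [x y|]; [exact: linD|exact: lin0].
Qed.

Lemma lin_id U : lin (fun x : U => x).
Proof. by []. Qed.

Lemma lin_comp U V A (g : V -> A) (f : U -> V) :
  lin g -> lin f -> lin (fun x => g (f x)).
Proof. by move=> gL fL c x y; rewrite fL gL. Qed.

Lemma lin_linear U V A (g : {linear V -> A}) (f : U -> V) :
  lin f -> lin (fun x => g (f x)).
Proof. by apply: lin_comp => c x y; apply: linearP. Qed.

Lemma lin_tensl U A B (f : U -> A) (b : B) :
  lin f -> lin (fun x => tens (f x) b).
Proof.
apply: (lin_comp (g := fun a => tens a b)).
exact: (tens_bilinear A B).1.
Qed.

Lemma lin_tensr U A B (f : U -> B) (a : A) :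
  lin f -> lin (fun x => tens a (f x)).
Proof. by apply: lin_comp; exact: (tens_bilinear A B).2. Qed.

Lemma lin_mull U (S : comAlgType K) (f : U -> S) s :
  lin f -> lin (fun x => f x * s).
Proof. by move=> fL c x y; rewrite fL mulrDl scalerAl. Qed.

Lemma lin_mulr U (S : comAlgType K) (f : U -> S) s :
  lin f -> lin (fun x => s * f x).
Proof. by move=> fL c x y; rewrite fL mulrDr scalerAr. Qed.

Definition bilin A B V (f : A -> B -> V) :=
  (forall b, lin (f^~ b)) /\ (forall a, lin (f a)).

Lemma lin_tlift_arg U A B V (f : A -> B -> V) (t : U -> tensor A B) :
  bilin f -> lin t -> lin (fun x => tlift f (t x)).
Proof.
by case=> f1 f2; apply: lin_comp => c x y; apply: tlift_linear; split.
Qed.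

Lemma bilin_tens A B : bilin (@tens K A B).
Proof. by split=> ?; [apply: lin_tensl|apply: lin_tensr]. Qed.

(* No bilinearity is needed: [tlift f t] is a linear combination of values of
   [f] with coefficients depending on [t] only. *)
Lemma lin_tlift_fun U A B V (f : U -> A -> B -> V) (t : tensor A B) :
  (forall a b, lin (fun x => f x a b)) -> lin (fun x => tlift (f x) t).
Proof.
move=> fL c x y; rewrite /tlift /free_lift scaler_sumr -big_split.
by apply: eq_bigr => p _; rewrite fL scalerDr !scalerA mulrC.
Qed.

Lemma eq_tlift A B V (f g : A -> B -> V) t : f =2 g -> tlift f t = tlift g t.
Proof.
by move=> fg; rewrite (_ : f = g) //; apply: funext => a; apply: funext.
Qed.

Lemma lin_tliftE A B V U (g : V -> U) (f : A -> B -> V) t :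
  lin g -> g (tlift f t) = tlift (fun a b => g (f a b)) t.
Proof.
move=> gL; rewrite /tlift /free_lift lin_sum //.
by apply: eq_bigr => p _; rewrite linZ.
Qed.

Lemma tliftE_bilin A B V (f : A -> B -> V) a b :
  bilin f -> tlift f (tens a b) = f a b.
Proof. by case=> f1 f2; apply: tliftE; split. Qed.

Lemma lin_tensor_ext A B V (f g : tensor A B -> V) : lin f -> lin g ->
  (forall a b, f (tens a b) = g (tens a b)) -> f =1 g.
Proof.
move=> fL gL fg; apply: tensor_ind => // [c s t fs ft|].
  by rewrite fL gL fs ft.
by rewrite !lin0.
Qed.

Lemma tlift_tens A B (t : tensor A B) : tlift (@tens K A B) t = t.
Proof.
apply: (lin_tensor_ext (f := tlift _)) t => // [|a b].
  exact: (lin_tlift_arg (bilin_tens A B)).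
exact/tliftE_bilin/bilin_tens.
Qed.

End Lin.

(** * Modules over a symmetric algebra *)

Section Monomials.
Variables (K : fieldType) (I : choiceType).

Lemma malg_ind (P : {malg K[I]} -> Prop) :
  (forall c p q, P p -> P q -> P (c *: p + q)) -> P 0 ->
  (forall k, P << k >>) -> forall p, P p.
Proof.
move=> PD P0 PU p; rewrite [p]monalgE; elim: (enum_fset _) => [|k s IHs].
  by rewrite big_nil.
rewrite big_cons (_ : << _ *g k >> = p@_k *: << k >>); first exact: PD.
by apply/malgP => l; rewrite mcoeffZ !mcoeffU mulr_natr.
Qed.

(** The order of the list is that of the enumeration of the support and carries no meaning, so
    products of monomials are compared up to permutation only. *)
Definition cmon_seq (g : {cmonom I}) : seq I :=
  flatten [seq nseq (g i) i | i <- finsupp g].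

Lemma count_cmon_seq g i : count_mem i (cmon_seq g) = g i.
Proof.
rewrite /cmon_seq count_flatten -map_comp sumnE big_map.
under eq_bigr => j _ do rewrite /= count_nseq.
case: (mdomP g i) => [gi|ngi].
  rewrite (bigD1_seq i) //= ?fset_uniq // eqxx mul1n big1 ?addn0 // => j.
  by move=> /negPf ->.
rewrite big1_seq // => j /andP[_ gj].
by rewrite /= (_ : j == i = false) //; apply: contraNF ngi => /eqP <-.
Qed.

Lemma cmon_seqM (g h : {cmonom I}) :
  perm_eq (cmon_seq (mmul g h)) (cmon_seq g ++ cmon_seq h).
Proof.
by apply/allP => i _ /=; rewrite count_cat !count_cmon_seq cmM.
Qed.

Lemma cmon_seqU i : perm_eq (cmon_seq (ucm i)) [:: i].
Proof. by apply/allP => j _ /=; rewrite count_cmon_seq cmU addn0. Qed.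

Lemma cmon_seq1 : cmon_seq mone = [::].
Proof. by rewrite /cmon_seq mdom1. Qed.

Lemma cmon_seqK g : \big[mmul/mone]_(i <- cmon_seq g) ucm i = g.
Proof.
apply/eqP/cmP => j; rewrite -[RHS]count_cmon_seq.
elim: (cmon_seq g) => [|i s IHs]; first by rewrite big_nil cm1.
by rewrite big_cons cmM cmU IHs.
Qed.

Lemma malgUM (k l : {cmonom I}) :
  << k >> * << l >> = << mmul k l >> :> {malg K[{cmonom I}]}.
Proof. by rewrite malgM_def fgmulUU mulr1. Qed.
End Monomials.

Section SymTheory.
Variables (K : fieldType) (W : lmodType K).

(** Monomials span the polynomial algebra and each is a product of variables, so products of
    elements of [W] span [Sym W]. *)
Lemma sym_ind (P : Sym W -> Prop) :
  (forall c x y, P x -> P y -> P (c *: x + y)) -> P 1 ->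
  (forall w m, P m -> P (sym_in w * m)) -> forall m, P m.
Proof.
move=> PD P1 PM m.
(* Zero is [(-1) *: 1 + 1]. *)
have P0 : P 0 by rewrite -[0](addNr 1) -scaleN1r; apply: PD.
rewrite -[m]sym_pi_repr; elim/malg_ind: (X in sym_pi X) => [c p q Pp Pq||k].
- by rewrite linearP; apply: PD.
- by rewrite linear0.
- rewrite -[k]cmon_seqK; elim: (cmon_seq k) => [|w s IHs].
    by rewrite big_nil -[<< _ >>]/(1 : {malg K[{cmonom W}]}) rmorph1.
  by rewrite big_cons -malgUM rmorphM; apply: PM.
Qed.

Variables (M : lmodType K) (rho : W -> M -> M) (Q : M -> Prop).

(* The submodule Q of M, on which the rho w are commuting endomorphisms
   depending linearly on w, is a module over the symmetric algebra of W. *)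
Record sym_action : Prop := SymAction {
  sym_action0 : Q 0;
  sym_actionD : forall c x y, Q x -> Q y -> Q (c *: x + y);
  sym_action_closed : forall w v, Q v -> Q (rho w v);
  sym_action_lin1 : forall v, Q v -> lin (rho^~ v);
  sym_action_lin2 : forall w, lin (rho w);
  sym_action_comm : forall w w' v, Q v -> rho w (rho w' v) = rho w' (rho w v)
}.

Hypothesis rhoP : sym_action.
Let Q0 := sym_action0 rhoP.
Let QD := sym_actionD rhoP.
Let Qrho := sym_action_closed rhoP.
Let rhoL1 := sym_action_lin1 rhoP.
Let rhoL2 := sym_action_lin2 rhoP.
Let rhoC := sym_action_comm rhoP.

Lemma foldr_closed s v : Q v -> Q (foldr rho v s).
Proof. by move=> Qv; elim: s => //= w s; apply: Qrho. Qed.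

Lemma foldr_commute s w v :
  Q v -> foldr rho (rho w v) s = rho w (foldr rho v s).
Proof.
by move=> Qv; elim: s => //= w' s ->; rewrite rhoC //; apply: foldr_closed.
Qed.

(** The head of [s] occurs somewhere in [t]; commuting it to the front of [t] reduces the claim to
    the tails. *)
Lemma foldr_perm s t v : Q v -> perm_eq s t -> foldr rho v s = foldr rho v t.
Proof.
move=> Qv; elim: s t => [|w s IHs] t st.
  by move: st; rewrite perm_sym => /perm_nilP ->.
have /splitPr tE : w \in t by rewrite -(perm_mem st) mem_head.
case: tE st => t1 t2 st /=; rewrite (IHs (t1 ++ t2)).
  by rewrite !foldr_cat /= foldr_commute //; apply: foldr_closed.
by move: st; rewrite perm_sym perm_catC /= perm_cons perm_catC perm_sym.
Qed.

Definition act_mon (k : {cmonom W}) v := foldr rho v (cmon_seq k).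

Lemma act_monL k : lin (act_mon k).
Proof.
rewrite /act_mon => c x y; elim: (cmon_seq k) => //= w s ->; exact: rhoL2.
Qed.

Definition act_poly (p : {malg K[{cmonom W}]}) v : M :=
  \sum_(k <- msupp p) p@_k *: act_mon k v.

Lemma act_polyEw (d : {fset {cmonom W}}) p v : (msupp p `<=` d)%fset ->
  act_poly p v = \sum_(k <- d) p@_k *: act_mon k v.
Proof.
move=> le; rewrite /act_poly (big_fset_incl _ le) // => k _ /mcoeff_outdom->.
by rewrite scale0r.
Qed.

Lemma act_polyL1 v : lin (act_poly^~ v).
Proof.
move=> c x y; pose d := (msupp x `|` msupp y `|` msupp (c *: x + y))%fset.
rewrite !(@act_polyEw d); try by rewrite /d ?fsubsetUr // -fsetUA
  ?fsubsetUl // fsetUCA fsubsetUl.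
rewrite scaler_sumr -big_split; apply: eq_bigr => p _.
by rewrite mcoeffD mcoeffZ scalerDl scalerA.
Qed.

Lemma act_polyL2 p : lin (act_poly p).
Proof.
move=> c x y; rewrite scaler_sumr -big_split; apply: eq_bigr => k _.
by rewrite act_monL scalerDr !scalerA mulrC.
Qed.

Lemma act_polyU k v : act_poly << k >> v = act_mon k v.
Proof.
by rewrite (act_polyEw _ msuppU_le) big_seq_fset1 mcoeffUU scale1r.
Qed.

Lemma act_poly_var w v : Q v -> act_poly (sym_var w) v = rho w v.
Proof.
by move=> Qv; rewrite act_polyU /act_mon (foldr_perm Qv (cmon_seqU w)).
Qed.

Lemma act_poly_closed p v : Q v -> Q (act_poly p v).
Proof.
move=> Qv; elim/malg_ind: p => [c p q Qp Qq||k].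
- by rewrite act_polyL1; apply: QD.
- by rewrite (lin0 (act_polyL1 v)).
- by rewrite act_polyU; apply: foldr_closed.
Qed.

Lemma act_polyM p q v : Q v -> act_poly (p * q) v = act_poly p (act_poly q v).
Proof.
move=> Qv; elim/malg_ind: p => [c p p' IHp IHp'||k].
- rewrite mulrDl -fgscaleAl [LHS]act_polyL1 [RHS]act_polyL1.
  by congr (_ *: _ + _); [exact: IHp|exact: IHp'].
- by rewrite mul0r [LHS](lin0 (act_polyL1 v)) [RHS](lin0 (act_polyL1 _)).
elim/malg_ind: q => [c q q' IHq IHq'||l].
- rewrite mulrDr -scalerAr [LHS]act_polyL1.
  rewrite (act_polyL1 v c q q') [RHS]act_polyL2.
  by congr (_ *: _ + _); [exact: IHq|exact: IHq'].
- rewrite mulr0 [LHS](lin0 (act_polyL1 v)).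
  by rewrite (lin0 (act_polyL1 v)) [RHS](lin0 (act_polyL2 _)).
rewrite (malgUM K k l).
rewrite [LHS]act_polyU [RHS]act_polyU (act_polyU l v) /act_mon.
by rewrite (foldr_perm Qv (cmon_seqM k l)) foldr_cat.
Qed.

(** The chosen representative makes this a total function; on vectors of [Q] the choice does not
    matter, by [act_pi]. *)
Definition act (m : Sym W) v := act_poly (repr m) v.

(** Two representatives differ by an element of the ideal, and the whole ideal kills [v]: the
    generators do because [rho] is linear in its first argument, and the annihilator is stable under
    sums and multiples. *)
Lemma act_pi p v : Q v -> act (sym_pi p) v = act_poly p v.
Proof.
move=> Qv; apply/eqP; rewrite -subr_eq0 /act -(linB _ _ (act_polyL1 v)).
apply/eqP.
have /sym_piP := sym_pi_repr (sym_pi p).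
apply: (@span_ind _ {malg K[{cmonom W}]}^o (@sym_rel K W)
  (fun p => act_poly p v = 0)) => [c x y x0 y0||_ [c w w']].
(* The ideal is a span over the polynomial ring itself, so [c] is a polynomial, and [c * x] acts by
   [x] first, then by [c]. *)
- apply: etrans (linD (c * x) y (act_polyL1 v)) _.
  by rewrite y0 addr0 act_polyM // x0 (lin0 (act_polyL2 c)).
- exact: lin0 (act_polyL1 v).
- rewrite (linB _ _ (act_polyL1 v)) act_poly_var // rhoL1 //.
  apply/eqP; rewrite subr_eq0 [X in _ == X]act_polyL1; apply/eqP.
  by congr (_ *: _ + _); symmetry; apply: act_poly_var.
Qed.

Lemma act_closed m v : Q v -> Q (act m v).
Proof. exact: act_poly_closed. Qed.

Lemma actL1 v : Q v -> lin (act^~ v).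
Proof.
move=> Qv c x y; rewrite -[x]sym_pi_repr -[y]sym_pi_repr -linearP !act_pi //.
exact: act_polyL1.
Qed.

Lemma actL2 m : lin (act m).
Proof. exact: act_polyL2. Qed.

Lemma act1 v : Q v -> act 1 v = v.
Proof.
move=> Qv; rewrite -(rmorph1 (@sym_pi K W)) act_pi //.
rewrite -[1]/(<< mone >> : {malg K[{cmonom W}]}) act_polyU /act_mon.
by rewrite cmon_seq1.
Qed.

Lemma actM m n v : Q v -> act (m * n) v = act m (act n v).
Proof.
move=> Qv; rewrite -[m]sym_pi_repr -[n]sym_pi_repr -rmorphM !act_pi //.
  exact: act_polyM.
exact: act_poly_closed.
Qed.

Lemma act_in w v : Q v -> act (sym_in w) v = rho w v.
Proof. by move=> Qv; rewrite act_pi // act_poly_var. Qed.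

End SymTheory.

(** * Consequences of the axioms of a dual lCEDS *)

Section Multilinear.
Variable K : fieldType.
Implicit Types (A B C D U V : lmodType K).

Lemma lin_bilin1 A B U V (f : A -> B -> V) (g : U -> A) b :
  bilin f -> lin g -> lin (fun x => f (g x) b).
Proof. by case=> fL _; apply: (lin_comp (fL b)). Qed.

Lemma lin_bilin2 A B U V (f : A -> B -> V) (g : U -> B) a :
  bilin f -> lin g -> lin (fun x => f a (g x)).
Proof. by case=> _ fL; apply: (lin_comp (fL a)). Qed.

Definition trilin A B C V (f : A -> B -> C -> V) :=
  [/\ forall b c, lin (fun a => f a b c), forall a c, lin (fun b => f a b c)
    & forall a b, lin (f a b)].

Lemma lin_trilin1 A B C U V (f : A -> B -> C -> V) (g : U -> A) b c :
  trilin f -> lin g -> lin (fun x => f (g x) b c).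
Proof. by case=> fL _ _; apply: (lin_comp (fL b c)). Qed.

Lemma lin_trilin2 A B C U V (f : A -> B -> C -> V) (g : U -> B) a c :
  trilin f -> lin g -> lin (fun x => f a (g x) c).
Proof. by case=> _ fL _; apply: (lin_comp (fL a c)). Qed.

Lemma lin_trilin3 A B C U V (f : A -> B -> C -> V) (g : U -> C) a b :
  trilin f -> lin g -> lin (fun x => f a b (g x)).
Proof. by case=> _ _ fL; apply: (lin_comp (fL a b)). Qed.

Lemma lin_sym_in U V (f : U -> V) : lin f -> lin (fun x => sym_in (f x)).
Proof. exact: (lin_linear (@sym_in K V)). Qed.

End Multilinear.

(** * Proof search for multilinearity *)

Ltac lin_step :=
  match goal with
  | |- bilin _ => split; intros ?
  | |- trilin _ => split; intros ? ?
  | |- lin (fun x => x) => exact (@lin_id _ _)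
  | |- lin (tens ?a) => apply (lin_tensr a (@lin_id _ _))
  | |- lin (fun x => tens (@?f x) ?b) => apply (lin_tensl (f := f) b)
  | |- lin (fun x => tens ?a (@?f x)) => apply (lin_tensr (f := f) a)
  | |- lin (fun x => @?f x * ?b) => apply (lin_mull (f := f) b)
  | |- lin (fun x => ?a * @?f x) => apply (lin_mulr (f := f) a)
  | |- lin (GRing.mul ?a) => apply (lin_mulr a (@lin_id _ _))
  | |- lin (fun x => sym_in (@?f x)) => apply (lin_sym_in (f := f))
  | |- lin (tlift ?f) =>
      apply (fun H => lin_tlift_arg (f := f) H (@lin_id _ _))
  | |- lin (fun x => tlift (@?f x) ?t) =>
      apply (lin_tlift_fun (f := f) t); intros ? ?
  | |- lin (fun x => tlift ?f (@?t x)) =>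
      apply (lin_tlift_arg (f := f) (t := t))
  | |- lin ?h => match goal with H : lin ?g |- _ => constr_eq g h; exact H end
  end.

Ltac lin_hyp :=
  match goal with
  | H : trilin ?h |- lin ?g =>
    match g with
    | h ?a ?b => apply (lin_trilin3 a b H (@lin_id _ _))
    | fun x => h (@?f x) ?b ?c => apply (lin_trilin1 (g := f) b c H)
    | fun x => h ?a (@?f x) ?c => apply (lin_trilin2 (g := f) a c H)
    | fun x => h ?a ?b (@?f x) => apply (lin_trilin3 (g := f) a b H)
    end
  | H : bilin ?h |- lin ?g =>
    match g with
    | h ?a => apply (proj2 H a)
    | fun x => h (@?f x) ?b => apply (lin_bilin1 (g := f) b H)
    | fun x => h ?a (@?f x) => apply (lin_bilin2 (g := f) a H)
    end
  | H : lin ?h |- lin ?g =>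
    match g with fun x => h (@?f x) => apply (lin_comp (f := f) H) end
  end.

Ltac lin := cbv beta; repeat (first [lin_step | lin_hyp]; cbv beta).

(** * The operators [slot] and the two axioms in Sweedler form *)

Section Slots.
Variables (K : fieldType) (A : lmodType K).

Lemma tmapE (B C D E : lmodType K) (f : B -> D) (g : C -> E) b c :
  lin f -> lin g -> tmap f g (tens b c) = tens (f b) (g c).
Proof. by move=> fL gL; rewrite /tmap tliftE_bilin; lin. Qed.

Lemma tmap_lin (B C D E : lmodType K) (f : B -> D) (g : C -> E) :
  lin f -> lin g -> lin (tmap f g).
Proof. by move=> fL gL; rewrite /tmap; lin. Qed.

Lemma tflipE (a b : A) : tflip (tens a b) = tens b a.
Proof. by rewrite /tflip tliftE_bilin; lin. Qed.

Lemma tflip_lin : lin (@tflip K A).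
Proof. by rewrite /tflip; lin. Qed.

Lemma tassocE (B C D : lmodType K) (t : tensor B C) (d : D) :
  tassoc (tens t d) = tlift (fun b c => tens b (tens c d)) t.
Proof. by rewrite /tassoc tliftE_bilin; lin. Qed.

Lemma tassoc_lin (B C D : lmodType K) : lin (@tassoc K B C D).
Proof. by rewrite /tassoc; lin. Qed.

Lemma tassocVE (B C D : lmodType K) (b : B) (c : C) (d : D) :
  tassocV (tens b (tens c d)) = tens (tens b c) d.
Proof. by rewrite /tassocV !tliftE_bilin; lin. Qed.

Lemma tassocV_lin (B C D : lmodType K) : lin (@tassocV K B C D).
Proof. by rewrite /tassocV; lin. Qed.

Lemma slot0_lin (f : tensor A A -> tensor A A) n :
  lin f -> lin (@slot0 K A f n).
Proof.
move=> fL; case: n => [|n] //=; apply: lin_comp; last exact: tassocV_lin.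
by apply: lin_comp; [exact: tassoc_lin|exact: tmap_lin].
Qed.

Lemma slot_lin (f : tensor A A -> tensor A A) i n :
  lin f -> lin (@slot K A f i n).
Proof.
move=> fL; elim: n i => [|n IHn] [|i] //=; first exact: slot0_lin.
exact: tmap_lin.
Qed.

Lemma lin_tensor3_ext (B C D U : lmodType K)
    (f g : tensor B (tensor C D) -> U) :
  lin f -> lin g ->
  (forall b c d, f (tens b (tens c d)) = g (tens b (tens c d))) -> f =1 g.
Proof.
move=> fL gL fg; apply: lin_tensor_ext => // b.
by apply: lin_tensor_ext => //; lin.
Qed.

(** Meant for trilinear [h]: applied to an equality of threefold tensors, it yields an equality of
    Sweedler sums with values in [U]. *)
Definition tlift3 (U : lmodType K) (h : A -> A -> A -> U) (t : tpow A 2) : U :=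
  tlift (fun a => tlift (h a)) t.

Section Lift3.
Variables (U : lmodType K) (h : A -> A -> A -> U).
Hypothesis hL : trilin h.

Lemma tlift3_lin : lin (tlift3 h).
Proof. by rewrite /tlift3; lin. Qed.

Lemma tlift3E a b c : tlift3 h (tens a (tens b c)) = h a b c.
Proof. by rewrite /tlift3 !tliftE_bilin; lin. Qed.

Variable f : tensor A A -> tensor A A.
Hypothesis fL : lin f.

(** An operator on tensors is absorbed into the trilinear map, so a composite of slots unfolds from
    the outermost one inwards. *)
Lemma tlift3_slot1 (t : tpow A 2) :
  tlift3 h (slot f 1 t) = tlift3 (fun a b c => tlift (h a) (f (tens b c))) t.
Proof.
move: t; apply: lin_tensor3_ext => [||a b c].
- exact: (lin_comp tlift3_lin (@slot_lin f 1 2 fL)).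
- by rewrite /tlift3; lin.
rewrite /= (tmapE _ _ (@lin_id K A) fL) /tlift3 !tliftE_bilin; by lin.
Qed.

Lemma tlift3_slot0 (t : tpow A 2) :
  tlift3 h (slot f 0 t) =
  tlift3 (fun a b c => tlift (fun p q => h p q c) (f (tens a b))) t.
Proof.
move: t; apply: lin_tensor3_ext => [||a b c].
- exact: (lin_comp tlift3_lin (@slot_lin f 0 2 fL)).
- by rewrite /tlift3; lin.
rewrite /= tassocVE (tmapE _ _ fL (@lin_id K A)) tassocE.
rewrite (lin_tliftE _ _ tlift3_lin).
rewrite [LHS](_ : _ = tlift (fun p q => h p q c) (f (tens a b))); last first.
  by apply: eq_tlift => p q; rewrite tlift3E.
by rewrite /tlift3 !tliftE_bilin; lin.
Qed.

End Lift3.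

Variable Phi : {linear tensor A A -> tensor A A}.
Hypothesis PhiP : dual_lCEDS Phi.

Lemma Phi_lin : lin Phi.
Proof. by move=> c x y; apply: linearP. Qed.

(** The first axiom at [tens a (tens b c)], with [h] applied to both sides; the flip brings [c] next
    to [p] and leaves [q] in the last place. *)
Lemma dual_lCEDS_mul (U : lmodType K) (h : A -> A -> A -> U) a b c :
  trilin h ->
  tlift (fun p q => tlift (fun s t => tlift (h s) (Phi (tens t q)))
    (Phi (tens a p))) (Phi (tens b c)) =
  tlift (fun p q => tlift (fun s t => h s t q) (Phi (tens p c)))
    (Phi (tens a b)).
Proof.
move=> hL; have PL := Phi_lin; have tL := tflip_lin.
have := congr1 (tlift3 h) (PhiP.1 (tens a (tens b c))); rewrite /comp.
rewrite [X in X = _ -> _]tlift3_slot1; [|solve [lin]..].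
rewrite [X in X = _ -> _]tlift3_slot0; [|solve [lin]..].
rewrite [X in X = _ -> _]tlift3_slot1; [|solve [lin]..].
rewrite [X in X = _ -> _]tlift3E; [|solve [lin]].
rewrite [X in _ = X -> _]tlift3_slot0; [|solve [lin]..].
rewrite [X in _ = X -> _]tlift3_slot1; [|solve [lin]..].
rewrite [X in _ = X -> _]tlift3_slot0; [|solve [lin]..].
rewrite [X in _ = X -> _]tlift3E; [|solve [lin]].
move=> ->; apply: eq_tlift => p q.
by rewrite tflipE tliftE_bilin; last lin.
Qed.

(** The second axiom at [tens a (tens b c)], read from right to left: [b] passes through [a] and
    then [c], or through [c] and then [a]. *)
Lemma dual_lCEDS_comm (U : lmodType K) (h : A -> A -> A -> U) a b c :
  trilin h ->
  tlift (fun p q => tlift (h p) (Phi (tens q c))) (Phi (tens b a)) =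
  tlift (fun p q => tlift (fun s t => h s p t) (Phi (tens q a)))
    (Phi (tens b c)).
Proof.
move=> hL; have PL := Phi_lin; have tL := tflip_lin.
(* Exchanging the last two arguments of [h] undoes the flip that comes last on the right-hand
   side. *)
have := congr1 (tlift3 (fun p q s => h p s q)) (PhiP.2 (tens a (tens b c))).
rewrite /comp.
rewrite [X in X = _ -> _]tlift3_slot0; [|solve [lin]..].
rewrite [X in X = _ -> _]tlift3_slot0; [|solve [lin]..].
rewrite [X in X = _ -> _]tlift3_slot1; [|solve [lin]..].
rewrite [X in X = _ -> _]tlift3_slot1; [|solve [lin]..].
rewrite [X in X = _ -> _]tlift3E; [|solve [lin]].
rewrite [X in _ = X -> _]tlift3_slot1; [|solve [lin]..].
rewrite [X in _ = X -> _]tlift3_slot1; [|solve [lin]..].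
rewrite [X in _ = X -> _]tlift3_slot0; [|solve [lin]..].
rewrite [X in _ = X -> _]tlift3_slot0; [|solve [lin]..].
rewrite [X in _ = X -> _]tlift3E; [|solve [lin]].
have flipE (f : A -> A -> U) x y :
    bilin f -> tlift f (tflip (tens x y)) = f y x.
  by move=> fL; rewrite tflipE tliftE_bilin.
move=> E; apply: etrans (etrans (esym E) _).
  rewrite flipE; last by lin.
  by apply: eq_tlift => p q; apply: eq_tlift => s t; rewrite flipE; last lin.
apply: eq_tlift => p q; rewrite flipE; last by lin.
by rewrite flipE; last lin.
Qed.

End Slots.

(** * Left multiplication in C_A(V) *)

Section SymTensor.
Variables (K : fieldType) (A V : lmodType K).
Local Notation S := (Sym (tensor A V)).

Lemma sym_tens_ind (P : S -> Prop) :
  (forall c m n, P m -> P n -> P (c *: m + n)) -> P 1 ->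
  (forall a x m, P m -> P (sym_in (tens a x) * m)) -> forall m, P m.
Proof.
move=> PD P1 PM; apply: sym_ind => // w m Pm.
have mL : lin (fun w => sym_in w * m) by lin.
elim/tensor_ind: w => [c s t Ps Pt||a x]; last exact: PM.
  by rewrite mL; apply: PD.
by rewrite (lin0 mL) -[0](addNr 1) -scaleN1r; apply: PD.
Qed.

(** Words in pure tensors span the symmetric algebra. The induction keeps [f] and [g] general: a
    letter is peeled off by composing them with multiplication by it. *)
Lemma sym_word_ext (U : lmodType K) (f g : S -> U) : lin f -> lin g ->
  (forall s, f (sym_word s) = g (sym_word s)) -> f =1 g.
Proof.
move=> fL gL fg m.
elim/sym_tens_ind: m f g fL gL fg => [c m n IHm IHn||a x m IHm].
- by move=> f g fL gL fg; rewrite fL gL (IHm f g) // (IHn f g).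
- by move=> f g _ _ /(_ [::]); rewrite /sym_word big_nil.
move=> f g fL gL fg.
apply: (IHm (fun m => f (_ * m)) (fun m => g (_ * m))) => [||s].
- by lin.
- by lin.
- by have := fg ((a, x) :: s); rewrite /sym_word big_cons.
Qed.

End SymTensor.

Section LeftMultiplier.
Variables (K : fieldType) (A V : lmodType K).
Variable Phi : {linear tensor A A -> tensor A A}.
Hypothesis PhiP : dual_lCEDS Phi.
Local Notation S := (Sym (tensor A V)).

Let PL : lin Phi := Phi_lin Phi.

Definition transfer (t : tensor A V) (g : A -> S) (q : A) : S :=
  tlift (fun a x =>
    tlift (fun p r => sym_in (tens p x) * g r) (Phi (tens q a))) t.

Lemma transferE a x g q : lin g -> transfer (tens a x) g q =
  tlift (fun p r => sym_in (tens p x) * g r) (Phi (tens q a)).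
Proof. by move=> gL; rewrite /transfer tliftE_bilin; last lin. Qed.

Lemma transfer_closed t g : lin g -> lin (transfer t g).
Proof. by move=> gL; rewrite /transfer; lin. Qed.

Lemma transfer_lin1 g : lin g -> lin (transfer^~ g).
Proof.
move=> gL c s t; apply: funext => q.
have tL : lin (fun t => transfer t g q) by rewrite /transfer; lin.
exact: tL.
Qed.

Lemma transfer_lin2 t : lin (transfer t).
Proof.
move=> c g h; apply: funext => q.
have tL : lin (fun g => transfer t g q) by rewrite /transfer; lin.
exact: tL.
Qed.

(** On pure tensors, the second axiom exchanges the order in which [q] passes [a] and [b];
    commutativity of the symmetric algebra then reorders the two new letters. *)
Lemma transfer_comm s t g : lin g ->
  transfer s (transfer t g) = transfer t (transfer s g).
Proof.
move=> gL; apply: funext => q; have tL t' := transfer_closed t' gL.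
move: s; apply: lin_tensor_ext => [||a x]; [by rewrite /transfer; lin..|].
move: t; apply: lin_tensor_ext => [||b y]; [by rewrite /transfer; lin..|].
rewrite [LHS](transferE _ _ _ (tL _)) [RHS](transferE _ _ _ (tL _)).
pose h p r s := sym_in (tens p x) * (sym_in (tens r y) * g s).
have hL : trilin h by rewrite /h; lin.
apply: etrans (etrans (dual_lCEDS_comm PhiP a q b hL) _).
  by apply: eq_tlift => p r; rewrite (transferE _ _ _ gL) lin_tliftE; last lin.
apply: eq_tlift => p r; rewrite (transferE _ _ _ gL) lin_tliftE; last by lin.
by apply: eq_tlift => p' r'; exact: mulrCA.
Qed.

Let lin_add c (g h : A -> S) : lin g -> lin h -> lin (c *: g + h).
Proof.
move=> gL hL c' x y.
rewrite -[LHS]/(c *: g (c' *: x + y) + h (c' *: x + y)).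
rewrite -[RHS]/(c' *: (c *: g x + h x) + (c *: g y + h y)).
by rewrite gL hL !scalerDr !scalerA mulrC addrACA.
Qed.

Let lin_zero : lin (0 : A -> S).
Proof. by move=> c x y; rewrite -[LHS]/0 -[RHS]/(c *: 0 + 0) scaler0 addr0. Qed.

(** The ambient space consists of all functions from [A] to the symmetric algebra, with the linear
    ones as the submodule, so that no type of linear maps has to be formed. *)
Lemma transfer_action : sym_action transfer (@lin K A S).
Proof.
exact: (SymAction lin_zero lin_add transfer_closed transfer_lin1
  transfer_lin2 transfer_comm).
Qed.

(* For X = (m | x), X <>_a (n | y) = (left_mul a m x * n | y). *)
Definition left_mul (a : A) (m : S) (x : V) : S :=
  act transfer m (fun q => sym_in (tens q x)) a.

Let start (x : V) : A -> S := fun q => sym_in (tens q x).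
Let start_lin x : lin (start x).
Proof. by rewrite /start; lin. Qed.

Lemma left_mul_trilin : trilin left_mul.
Proof.
split=> [m x|a x|a m].
(* Linearity in [a] says that the action preserves linear functions. *)
- exact: (act_closed transfer_action m (start_lin x)).
- move=> c m n; rewrite /left_mul.
  by rewrite (actL1 transfer_action (start_lin x)).
have aL := actL2 transfer_action m; move=> c x y.
rewrite -[LHS]/(act transfer m (start (c *: x + y)) a).
have -> : start (c *: x + y) = c *: start x + start y.
  apply: funext => q; have sL : lin (start^~ q) by rewrite /start; lin.
  exact: sL.
by rewrite aL.
Qed.

Lemma left_mul1 a x : left_mul a 1 x = sym_in (tens a x).
Proof. by rewrite /left_mul (act1 transfer_action (start_lin x)). Qed.

Lemma left_mul_cons a b y m x :
  left_mul a (sym_in (tens b y) * m) x =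
  tlift (fun p q => sym_in (tens p y) * left_mul q m x) (Phi (tens a b)).
Proof.
have acL := act_closed transfer_action m (start_lin x).
rewrite /left_mul (actM transfer_action _ _ (start_lin x)).
rewrite (act_in transfer_action _ acL).
exact: transferE.
Qed.

Lemma left_mul_left_mul a b m n x y :
  left_mul a (left_mul b m x * n) y =
  tlift (fun p q => left_mul p m x * left_mul q n y) (Phi (tens a b)).
Proof.
have lL := left_mul_trilin.
elim/sym_tens_ind: m a b => [c m m' IHm IHm' a b||c z m IHm a b].
- have fL : lin (fun m => left_mul a (left_mul b m x * n) y) by lin.
  have gL : lin (fun m => tlift (fun p q => left_mul p m x * left_mul q n y)
    (Phi (tens a b))) by lin.
  by rewrite [LHS]fL [RHS]gL; congr (_ *: _ + _).
- move=> a b; rewrite left_mul1 left_mul_cons.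
  by apply: eq_tlift => p q; rewrite left_mul1.
rewrite left_mul_cons.
pose g := fun s => left_mul a (s * n) y.
have gL : lin g by rewrite /g; lin.
rewrite -[LHS]/(g _) (lin_tliftE _ _ gL).
(* The first output leg decorates [z]; the other two feed the multipliers of [m | x] and [n | y]. *)
pose h p q r := sym_in (tens p z) * (left_mul q m x * left_mul r n y).
have hL : trilin h by rewrite /h; lin.
(* The recursion and the induction hypothesis expand the left side, the recursion alone the right
   side; the results are the two sides of the first axiom. *)
apply: etrans (etrans (dual_lCEDS_mul PhiP a b c hL) _).
  apply: eq_tlift => p q; rewrite /g -mulrA left_mul_cons.
  apply: eq_tlift => p' q'; rewrite IHm lin_tliftE //; lin.
apply: eq_tlift => p q; rewrite left_mul_cons.
pose k := fun s => s * left_mul q n y.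
have kL : lin k by rewrite /k; lin.
rewrite -[RHS]/(k _) (lin_tliftE _ _ kL).
by apply: eq_tlift => p' q'; rewrite /h /k mulrA.
Qed.

End LeftMultiplier.

(** * C_A(V) as a free permutative algebra *)

Section Chain.
Variables (K : fieldType) (A V : lmodType K).
Variable Phi : {linear tensor A A -> tensor A A}.

Let PL : lin Phi := Phi_lin Phi.

Lemma slot_chain_lin n (r : seq nat) :
  lin (fun t : tpow A n => foldl (fun u i => slot Phi i u) t r).
Proof.
elim: r => [|i r IHr] //=; apply: (lin_comp IHr); exact: slot_lin.
Qed.

Lemma Phi_chain_lin n : lin (@Phi_chain K A Phi n).
Proof. exact: slot_chain_lin. Qed.

Lemma tmap_comp (B C D : lmodType K) (f : C -> D) (g : B -> C)
    (t : tensor A B) :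
  lin f -> lin g -> tmap id f (tmap id g t) = tmap id (fun x => f (g x)) t.
Proof.
move=> fL gL; have iL := @lin_id K A; have fgL := lin_comp fL gL.
move: t; apply: lin_tensor_ext => [||a b].
- exact: lin_comp (tmap_lin iL fL) (tmap_lin iL gL).
- exact: tmap_lin.
by rewrite (tmapE _ _ iL gL) (tmapE _ _ iL fL) (tmapE _ _ iL fgL).
Qed.

Lemma tmap_id (B C : lmodType K) (t : tensor B C) : tmap id id t = t.
Proof. exact: tlift_tens. Qed.

(** After the first factor, all slots have positive index, fix the first leg, and form the shorter
    chain on the other legs. *)
Lemma Phi_chainS n (t : tpow A n.+1) :
  Phi_chain Phi t = tmap id (@Phi_chain K A Phi n) (slot0 Phi t).
Proof.
rewrite /Phi_chain /= -[1%N]/(1 + 0)%N iotaDl.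
move: (slot0 _ _) => u; elim: (iota 0 n) u => [|i r IHr] u /=.
  by rewrite tmap_id.
by rewrite IHr tmap_comp; [|exact: slot_chain_lin|exact: slot_lin].
Qed.

Lemma slot0_CA_tens a b (s : seq (A * V)) :
  slot0 Phi (tens a (CA_tens b s)) =
  tlift (fun p q => tens p (CA_tens q s)) (Phi (tens a b)).
Proof.
(* For empty [s], [slot0] is [Phi] itself; otherwise the tensor is rebracketed before and after
   [Phi]. *)
case: s => [|p s] /=; first by rewrite tlift_tens.
by rewrite tassocVE (tmapE _ _ PL (@lin_id K _)) tassocE.
Qed.

Lemma CA_decorate_lin s (x : V) : lin (@CA_decorate K A V s x).
Proof. by elim: s => [|p s IHs] /=; lin. Qed.

Hypothesis PhiP : dual_lCEDS Phi.

(** The explicit formula obeys the recursion of [left_mul]: its first factor consumes the first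
    letter and the rest is the formula for the shorter word. It therefore depends only on the
    product of the letters. *)
Lemma CA_decorateE (s : seq (A * V)) x a :
  CA_decorate x (Phi_chain Phi (CA_tens a s)) = left_mul Phi a (sym_word s) x.
Proof.
elim: s a => [|[b y] s IHs] a.
  by rewrite /sym_word big_nil left_mul1.
rewrite /sym_word big_cons left_mul_cons // [CA_tens _ _]/=.
rewrite Phi_chainS slot0_CA_tens.
have cL := @Phi_chain_lin (size s); have dL := @CA_decorate_lin s x.
have tL := tmap_lin (@lin_id K A) cL.
have dcL := lin_comp (@CA_decorate_lin ((b, y) :: s) x) tL.
rewrite (lin_tliftE _ _ dcL); apply: eq_tlift => p q.
by rewrite (tmapE _ _ (@lin_id K A) cL) /= tliftE_bilin ?IHs //; lin.
Qed.

End Chain.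

(** * The product on [CA] and its permutativity *)

Section Free.
Variables (K : fieldType) (A V : lmodType K).
Variable Phi : {linear tensor A A -> tensor A A}.
Hypothesis PhiP : dual_lCEDS Phi.
Local Notation CA := (CA A V).

Let lL : trilin (left_mul Phi (V := V)) := left_mul_trilin V PhiP.

Definition CA_mul (a : A) (X Y : CA) : CA :=
  tlift (fun m x => tlift (fun n y => tens (left_mul Phi a m x * n) y) Y) X.

Lemma CA_mulE a m x n y :
  CA_mul a (tens m x) (tens n y) = tens (left_mul Phi a m x * n) y.
Proof. by rewrite /CA_mul !tliftE_bilin; lin. Qed.

Lemma CA_mul_trilin : trilin CA_mul.
Proof. by rewrite /CA_mul; lin. Qed.

Lemma trilinearP (W : lmodType K) (d : A -> W -> W -> W) :
  trilinear d <-> trilin d.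
Proof.
split=> [[d1 d23]|[d1 d2 d3]].
  by split=> [x y|a y|a x]; [exact: d1|exact: (d23 a).1|exact: (d23 a).2].
by split=> [x y|a]; [exact: d1|split=> z; [exact: d2|exact: d3]].
Qed.

Lemma CA_product_mul : CA_product Phi CA_mul.
Proof.
split; first exact/trilinearP/CA_mul_trilin.
by move=> a s x t y; rewrite CA_mulE CA_decorateE.
Qed.

(** The terms span: trilinearity reduces both factors to pure tensors, then their symmetric parts to
    words, where the formula decides. *)
Lemma CA_product_unique d : CA_product Phi d -> d = CA_mul.
Proof.
move=> [/trilinearP dL dE]; have mL := CA_mul_trilin.
apply: funext => a; apply: funext => X; apply: funext => Y.
move: X; apply: lin_tensor_ext => [||m x]; [by lin..|].
move: Y; apply: lin_tensor_ext => [||n y]; [by lin..|].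
move: m; apply: sym_word_ext => [||s]; [by lin..|].
move: n; apply: sym_word_ext => [||t]; [by lin..|].
by rewrite [LHS]dE CA_mulE CA_decorateE.
Qed.

Lemma CA_mul_permutative : permutative Phi CA_mul.
Proof.
have mL := CA_mul_trilin.
have PL := Phi_lin Phi.
split; first exact/trilinearP.
- move=> a b X Y Z.
  move: X; apply: lin_tensor_ext => [||m x]; [by lin..|].
  move: Y; apply: lin_tensor_ext => [||n y]; [by lin..|].
  move: Z; apply: lin_tensor_ext => [||l z]; [by lin..|].
  rewrite !CA_mulE left_mul_left_mul //.
  have gL : lin (fun t => tens (t * l) z : CA) by lin.
  rewrite [LHS](lin_tliftE _ _ gL); apply: eq_tlift => p q.
  by rewrite !CA_mulE mulrA.
move=> a b X Y Z.
move: X; apply: lin_tensor_ext => [||m x]; [by lin..|].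
move: Y; apply: lin_tensor_ext => [||n y]; [by lin..|].
move: Z; apply: lin_tensor_ext => [||l z]; [by lin..|].
(* Both sides are the product of two multipliers and [l], up to the order of the factors. *)
rewrite [X in CA_mul a _ X = _]CA_mulE [X in _ = CA_mul b _ X]CA_mulE.
rewrite [LHS]CA_mulE [RHS]CA_mulE.
exact: (congr1 (fun s => tens s z) (mulrCA _ _ _)).
Qed.

(** * The universal property *)

Section Universal.
Variables (W : lmodType K) (d : A -> W -> W -> W).
Hypothesis dP : permutative Phi d.
Variable f : {linear V -> W}.

Let dL : trilin d.
Proof. by case: dP => /trilinearP. Qed.
Let PL : lin Phi := Phi_lin Phi.
Let fL : lin f.
Proof. by move=> c x y; apply: linearP. Qed.

Definition gen_act (t : tensor A V) (w : W) : W :=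
  tlift (fun a x => d a (f x) w) t.

Lemma gen_actE a x w : gen_act (tens a x) w = d a (f x) w.
Proof. by rewrite /gen_act tliftE_bilin; last lin. Qed.

(** The second permutative identity makes these operators commute on all of [W], so the submodule is
    everything. *)
Lemma gen_act_action : sym_action gen_act (fun _ => True).
Proof.
split=> // [v _|t|s t v _]; [by rewrite /gen_act; lin..|].
move: s; apply: lin_tensor_ext => [||a x]; [by rewrite /gen_act; lin..|].
move: t; apply: lin_tensor_ext => [||b y]; [by rewrite /gen_act; lin..|].
by rewrite !gen_actE; case: dP.
Qed.

Let actL : bilin (act gen_act).
Proof.
by split=> [v|m]; [exact: (actL1 gen_act_action)|exact: (actL2 gen_act_action)].
Qed.

Lemma act_gen_in a x w : act gen_act (sym_in (tens a x)) w = d a (f x) w.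
Proof. by rewrite (act_in gen_act_action) // gen_actE. Qed.

Lemma act_gen_cons a x m w :
  act gen_act (sym_in (tens a x) * m) w = d a (f x) (act gen_act m w).
Proof. by rewrite (actM gen_act_action) // act_gen_in. Qed.

Lemma act_left_mul a m x w :
  act gen_act (left_mul Phi a m x) w = d a (act gen_act m (f x)) w.
Proof.
elim/sym_tens_ind: m a => [c m n IHm IHn||b y m IHm] a.
- have gL : lin (fun m => act gen_act (left_mul Phi a m x) w) by lin.
  have hL : lin (fun m => d a (act gen_act m (f x)) w) by lin.
  by rewrite [LHS]gL [RHS]hL; congr (_ *: _ + _).
- by rewrite left_mul1 // act_gen_in (act1 gen_act_action).
have gL : lin (fun m => act gen_act m w) by lin.
rewrite left_mul_cons // [LHS](lin_tliftE _ _ gL) act_gen_cons.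
(* The first permutative identity, with [f y] as innermost left factor, mirrors the recursion of
   [left_mul]. *)
have [_ -> _] := dP; apply: eq_tlift => p q.
by rewrite act_gen_cons IHm.
Qed.

Definition CA_lift (X : CA) : W := tlift (fun m x => act gen_act m (f x)) X.

Lemma CA_lift_lin : lin CA_lift.
Proof. by rewrite /CA_lift; lin. Qed.

Lemma CA_liftE m x : CA_lift (tens m x) = act gen_act m (f x).
Proof. by rewrite /CA_lift tliftE_bilin; last lin. Qed.

(** The action turns a product of symmetric parts into a composite, and [act_left_mul] identifies
    the outer operator with multiplication by [CA_lift X]. *)
Lemma CA_lift_morph : product_morphism CA_mul d CA_lift.
Proof.
move=> a X Y; have mL := CA_mul_trilin; have FL := CA_lift_lin.
move: X; apply: lin_tensor_ext => [||m x]; [by lin..|].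
move: Y; apply: lin_tensor_ext => [||n y]; [by lin..|].
rewrite CA_mulE [LHS]CA_liftE [X in _ = d a X _]CA_liftE.
by rewrite [X in _ = d a _ X]CA_liftE (actM gen_act_action) // act_left_mul.
Qed.

Lemma CA_inE (x : V) : CA_in A x = tens 1 x.
Proof. by rewrite /CA_in /CA_term /sym_word big_nil. Qed.

Lemma CA_lift_in (x : V) : CA_lift (CA_in A x) = f x.
Proof. by rewrite CA_inE CA_liftE (act1 gen_act_action). Qed.

(** [V] generates: [a y * m | x] is the product of [1 | y] and [m | x] with parameter [a], so
    induction on [m] determines [F]. *)
Lemma CA_lift_unique (F : CA -> W) : lin F ->
  product_morphism CA_mul d F -> (forall x, F (CA_in A x) = f x) ->
  F =1 CA_lift.
Proof.
move=> FL FM Ff; have cL := CA_lift_lin.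
apply: lin_tensor_ext => // m x.
rewrite CA_liftE; elim/sym_tens_ind: m => [c m n IHm IHn||a y m IHm].
- have gL : lin (fun m => F (tens m x)) by lin.
  have hL : lin (fun m => act gen_act m (f x)) by lin.
  by rewrite [LHS]gL [RHS]hL; congr (_ *: _ + _).
- by rewrite -CA_inE Ff (act1 gen_act_action).
by rewrite act_gen_cons -IHm -(Ff y) -FM CA_inE CA_mulE left_mul1.
Qed.

End Universal.

Lemma CA_mul_free : free_permutative Phi CA_mul (@CA_in K A V).
Proof.
split=> [|W d dP f]; first exact: CA_mul_permutative.
pose FM := GRing.isLinear.Build K CA W *:%R (CA_lift d f) (CA_lift_lin dP f).
pose F : {linear CA -> W} := HB.pack (CA_lift d f) FM.
exists F; split=> [|x|F' F'M F'f].
- exact: CA_lift_morph.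
- exact: CA_lift_in.
apply: CA_lift_unique => //.
by move=> c x y; apply: linearP.
Qed.

End Free.

Theorem proposition3p3 (K : fieldType) (charK : [pchar K] =i pred0)
    (A : lmodType K) (Phi : {linear tensor A A -> tensor A A})
    (PhiP : dual_lCEDS Phi) (V : lmodType K) :
  (exists! d : A -> CA A V -> CA A V -> CA A V, CA_product Phi d) /\
  (forall d : A -> CA A V -> CA A V -> CA A V,
     CA_product Phi d -> free_permutative Phi d (@CA_in K A V)).
Proof.
split.
  exists (@CA_mul K A V Phi); split; first exact: CA_product_mul.
  by move=> d /(CA_product_unique PhiP).
(* Uniqueness identifies any product obeying the formula with [CA_mul]. *)
move=> d /(CA_product_unique PhiP) ->; exact: CA_mul_free.
Qed.
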